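(* Let $S\in\mathcal M_d(\mathbb C)^+$, let $\mathbf a=(a_i)_{i\in\mathbb I_k}\in(\mathbb R^k_{>0})^\downarrow$, and let $N$ be a strictly convex unitarily invariant norm on $\mathcal M_d(\mathbb C)$. Let $\mathcal G_0=\{g_i\}_{i\in\mathbb I_k}\in\mathbb T_d(\mathbf a)$ be a local minimizer of $\Theta:\mathbb T_d(\mathbf a)\to\mathbb R_{\ge0}$, $\Theta(\mathcal G)=N(S-S_{\mathcal G})$, with frame operator $S_0=S_{\mathcal G_0}$. Then: 1. $S-S_0$ and $g_j\otimes g_j$ commute, for $j\in\mathbb I_k$. Hence, $g_j$ is an eigenvector of $S-S_0$, for $j\in\mathbb I_k$. 2. There exists an orthonormal basis $\{v_i\}_{i\in\mathbb I_d}$ of $\mathbb C^d$ such that $$S=\sum_{i\in\mathbb I_d}\lambda_i(S)\ v_i\otimes v_i\quad\text{and}\quad S_0=\sum_{i\in\mathbb I_d}\lambda_i(S_0)\ v_i\otimes v_i.$$ In particular, $\lambda(S-S_0)=[\lambda(S)-\lambda(S_0)]^\downarrow$.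
   Context: $\mathbb I_n=\{1,\dots,n\}$. $\mathcal M_d(\mathbb C)$ is the algebra of complex $d\times d$ matrices and $\mathcal M_d(\mathbb C)^+$ the cone of positive semidefinite matrices. For $x\in\mathbb R^d$, $x^\downarrow$ is the non-increasing rearrangement of $x$; $(\mathbb R^k_{>0})^\downarrow$ is the set of vectors in $\mathbb R^k$ with positive entries in non-increasing order. For selfadjoint $A$, $\lambda(A)=(\lambda_i(A))_{i\in\mathbb I_d}$ is the vector of eigenvalues counting multiplicities in non-increasing order. For $x,y\in\mathbb C^d$, $(x\otimes y)z=\langle z,y\rangle x$. A norm $N$ is unitarily invariant if $N(UAV)=N(A)$ for all $A\in\mathcal M_d(\mathbb C)$ and all unitary $U,V$. $\mathbb T_d(\mathbf a)=\{\mathcal G=\{g_i\}_{i\in\mathbb I_k}\in(\mathbb C^d)^k:\|g_i\|^2=a_i\text{ for every }i\in\mathbb I_k\}$, with the metric $d(\mathcal G,\mathcal G')=\max\{\|g_i-g_i'\|:i\in\mathbb I_k\}$. The frame operator of $\mathcal G=\{g_i\}_{i\in\mathbb I_k}$ is $S_{\mathcal G}=\sum_{i\in\mathbb I_k}g_i\otimes g_i\in\mathcal M_d(\mathbb C)^+$. *)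

(* Defs.v *)
From mathcomp Require Import all_boot all_order all_algebra.
From mathcomp Require Export spectral sesquilinear complex reals.

Set Implicit Arguments.
Unset Strict Implicit.
Unset Printing Implicit Defensive.

Import Order.TTheory GRing.Theory Num.Theory.
Local Open Scope ring_scope.
Local Open Scope sesquilinear_scope.
Local Open Scope complex_scope.

Section Vectors.
Variables (R : realType) (d : nat).
Local Notation C := R[i].

(* Linear in the first argument, antilinear in the second. *)
Definition inner (x y : 'cV[C]_d) : C := (y^t* *m x) 0 0.

Definition vnorm (x : 'cV[C]_d) : R := Num.sqrt (complex.Re (inner x x)).

(* Rank-one operator: (x ⊗ y) z = <z, y> x, see [tensorE]. *)
Definition tensor (x y : 'cV[C]_d) : 'M[C]_d := x *m y^t*.

Lemma tensorE (x y z : 'cV[C]_d) : tensor x y *m z = inner z y *: x.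
Proof.
rewrite /tensor -mulmxA /inner; set c := _ *m z.
by rewrite {1}[c]mx11_scalar mul_mx_scalar.
Qed.

Definition orthonormal_basis (v : 'I_d -> 'cV[C]_d) : Prop :=
  (forall i j, inner (v i) (v j) = (i == j)%:R) /\ basis_of fullv (codom v).

Definition eigenvector (A : 'M[C]_d) (x : 'cV[C]_d) : Prop :=
  x != 0 /\ exists c : C, A *m x = c *: x.

Definition psdmx (A : 'M[C]_d) : Prop :=
  A \is hermsymmx /\ forall x : 'cV[C]_d, 0 <= inner (A *m x) x.

End Vectors.

Section Rearrangement.
Variables (R : realType) (d : nat).
Local Notation C := R[i].

Definition decr_rearr (x : 'rV[R]_d) : 'rV[R]_d :=
  \row_i (sort >=%R [seq x 0 j | j <- enum 'I_d])`_i.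

Definition eigenvalues (A : 'M[C]_d) : seq C :=
  sval (closed_field_poly_normal (char_poly A)).

(* Taking real parts loses nothing on selfadjoint matrices, the only ones this
   is meant for: see [char_poly_lambda]. *)
Definition lambda (A : 'M[C]_d) : 'rV[R]_d :=
  decr_rearr (\row_i complex.Re (eigenvalues A)`_i).

End Rearrangement.

Section MatrixNorms.
Variables (R : realType) (d : nat).
Local Notation C := R[i].

Definition is_norm (N : 'M[C]_d -> R) : Prop :=
  [/\ forall A, 0 <= N A,
      forall A, N A = 0 -> A = 0,
      forall (c : C) A, N (c *: A) = complex.Re `|c| * N A
    & forall A B, N (A + B) <= N A + N B].

Definition unitarily_invariant (N : 'M[C]_d -> R) : Prop :=
  forall A U V : 'M[C]_d, U \is unitarymx -> V \is unitarymx ->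
    N (U *m A *m V) = N A.

Definition strictly_convex (N : 'M[C]_d -> R) : Prop :=
  forall (A B : 'M[C]_d) (t : R), N A = 1 -> N B = 1 -> A <> B ->
    0 < t -> t < 1 -> N (t%:C *: A + (1 - t)%:C *: B) < 1.

End MatrixNorms.

Section Frames.
Variables (R : realType) (d k : nat).
Local Notation C := R[i].
Implicit Types (a : 'rV[R]_k) (G : 'I_k -> 'cV[C]_d).

Definition pos_decr a : Prop :=
  (forall i, 0 < a 0 i) /\ (forall i j : 'I_k, (i <= j)%N -> a 0 j <= a 0 i).

Definition prescribed_norms a G : Prop := forall i, vnorm (G i) ^+ 2 = a 0 i.

Definition seq_dist G G' : R := \big[Num.max/0]_(i < k) vnorm (G i - G' i).

Definition frame_op G : 'M[C]_d := \sum_(i < k) tensor (G i) (G i).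

Definition Theta (N : 'M[C]_d -> R) (S : 'M[C]_d) G : R := N (S - frame_op G).

Definition local_minimizer a (f : ('I_k -> 'cV[C]_d) -> R) G : Prop :=
  prescribed_norms a G /\
  exists2 e : R, 0 < e &
    forall G', prescribed_norms a G' -> seq_dist G G' < e -> f G <= f G'.

End Frames.

Section EigenvalueFacts.
Variables (R : realType) (d : nat).
Local Notation C := R[i].

Lemma char_poly_eigenvalues (A : 'M[C]_d) :
  char_poly A = \prod_(z <- eigenvalues A) ('X - z%:P).
Proof.
rewrite /eigenvalues; case: closed_field_poly_normal => r /= E.
by rewrite {1}E (monicP (char_poly_monic A)) scale1r.
Qed.

Lemma size_eigenvalues (A : 'M[C]_d) : size (eigenvalues A) = d.
Proof.
have := size_char_poly A.
by rewrite char_poly_eigenvalues size_prod_XsubC => -[].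
Qed.

Lemma decr_rearr_perm (x : 'rV[R]_d) :
  perm_eq [seq decr_rearr x 0 i | i <- enum 'I_d] [seq x 0 i | i <- enum 'I_d].
Proof.
set s := [seq x 0 i | i <- _].
have ss : size (sort >=%R s) = d by rewrite size_sort size_map size_enum_ord.
suff -> : [seq decr_rearr x 0 i | i <- enum 'I_d] = sort >=%R s.
  by rewrite perm_sort.
apply: (@eq_from_nth _ 0) => [|i]; first by rewrite size_map size_enum_ord ss.
rewrite size_map size_enum_ord => lid.
by rewrite (nth_map (Ordinal lid)) ?size_enum_ord// mxE nth_enum_ord.
Qed.

Lemma decr_rearr_decr (x : 'rV[R]_d) (i j : 'I_d) :
  (i <= j)%N -> decr_rearr x 0 j <= decr_rearr x 0 i.
Proof.
move=> lij; rewrite !mxE; set s := [seq x 0 i | i <- _].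
have ss : size (sort >=%R s) = d by rewrite size_sort size_map size_enum_ord.
have tr : transitive (>=%R : rel R).
  by move=> a b c /= ba ac; exact: le_trans ac ba.
have so : sorted >=%R (sort >=%R s).
  by apply: sort_sorted => a b /=; exact: le_total.
by apply: (sorted_leq_nth tr (@lexx _ R) 0 so); rewrite ?inE ?ss.
Qed.

Lemma hermsymmx_eigenvalue_real (A : 'M[C]_d) (z : C) :
  A \is hermsymmx -> z \in eigenvalues A -> (complex.Re z)%:C = z.
Proof.
move=> hA zA.
have : root (char_poly A) z by rewrite char_poly_eigenvalues root_prod_XsubC.
have /orthomx_spectralP EA := hermitian_normalmx hA.
rewrite -eigenvalue_root_char => /eigenvalueP[v vA v0].
have U := spectral_unit A; pose w := v *m invmx (spectralmx A).
have w0 : w != 0.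
  by apply: contra v0 => /eqP/(congr1 (mulmx^~ (spectralmx A)));
     rewrite mulmxKV// mul0mx => ->.
have wE : w *m diag_mx (spectral_diag A) = z *: w.
  apply: (can_inj (mulmxK U)).
  by rewrite -scalemxAl mulmxKV// -vA {3}EA !mulmxA.
clearbody w.
have [j wj] : exists j, w 0 j != 0 by apply/rV0Pn.
have := congr1 (fun M : 'rV__ => M 0 j) wE.
rewrite mul_mx_diag !mxE mulrC => /(mulIf wj) <-.
have /mxOverP/(_ 0 j) := hermitian_spectral_diag_real hA.
by move=> /complex_realP[c ->].
Qed.

Lemma char_poly_lambda (A : 'M[C]_d) : A \is hermsymmx ->
  char_poly A = \prod_(i < d) ('X - ((lambda A 0 i)%:C)%:P).
Proof.
move=> hA; rewrite char_poly_eigenvalues.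
transitivity (\prod_(x <- [seq lambda A 0 i | i <- enum 'I_d])
    ('X - (x%:C)%:P)).
  rewrite (perm_big _ (decr_rearr_perm _)) /= big_map big_enum /=.
  rewrite (big_nth 0) size_eigenvalues big_mkord; apply: eq_bigr => i _.
  by rewrite mxE (hermsymmx_eigenvalue_real hA)// mem_nth// size_eigenvalues.
by rewrite big_map big_enum.
Qed.

End EigenvalueFacts.

(* Main.v *)
Require Import Defs.
From mathcomp Require Import all_boot all_order all_algebra.
From mathcomp Require Import spectral sesquilinear complex reals.
From mathcomp Require Import perm ring lra.

Set Implicit Arguments.
Unset Strict Implicit.
Unset Printing Implicit Defensive.

Import Order.TTheory GRing.Theory Num.Theory.
Local Open Scope ring_scope.
Local Open Scope complex_scope.

(** Write [X = A - B], where [B] is a sum of some of the [g_i ⊗ g_i] and [A] is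
    [S] minus the sum of the others, so that [X = S - S_0] always.  Moving the
    vectors of [B] by a unitary [U] near the identity keeps their norms, so
    [N (A - B) <= N (A - U B U^-1)] for such [U]: [B] is a local minimizer on
    its unitary orbit.  Everything follows from that.

    For [0 < c < 1] put [T = (1 - c) A + c B], so that [A = T + c X] and
    [B = T - (1 - c) X].  If [U] commutes with [T], then
    [[ A - U B U^-1 = c X + (1 - c) U X U^-1. ]]
    The right-hand side is a strict convex combination of two matrices of the
    same norm, so strict convexity makes its norm smaller than [N X], unless
    [U X U^-1 = X] ([unitary_min_fixes]).  Local minimality therefore forces [X]
    to commute with every [U] near the identity that commutes with [T].  For a
    unit eigenvector [v] of [T], the unitary [1 + (z - 1) v ⊗ v], with
    [|z| = 1] and [z <> 1] near [1], is such a [U]; hence every eigenvector of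
    [T] is an eigenvector of [X] ([phase_minimal_eigen]), and this for every
    [c].

    With [c = 1/2], an orthonormal eigenbasis of [A + B] diagonalizes [X], hence
    [A] and [B] ([phase_minimal_diag]).  With the other values of [c], the
    eigenvalues of [A] and [B] on this basis cannot be oppositely ordered
    ([phase_minimal_no_crossing]): if [al_i > al_j] while [be_i < be_j], some
    [c] gives [T] the same eigenvalue on [v_i] and [v_j]; then [v_i + v_j] is an
    eigenvector of [T], so of [X], so [al_i - be_i = al_j - be_j], which is
    absurd.  Listing the basis by
    decreasing eigenvalue of [A + B] thus sorts both spectra.

    The commutation with [g_j ⊗ g_j] is the case where [B] is that single
    tensor; the common ordered eigenbasis of [S] and [S_0] is the case where
    [B] is the whole frame operator [S_0]. *)

(** * Adjoints, inner products and rank-one operators *)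

Section Adjoint.
Local Open Scope sesquilinear_scope.
Variable R : realType.
Local Notation C := R[i].

Lemma adjM m n p (A : 'M[C]_(m, n)) (B : 'M_(n, p)) :
  (A *m B)^t* = B^t* *m A^t*.
Proof. by rewrite trmx_mul map_mxM. Qed.

Lemma adjD m n (A B : 'M[C]_(m, n)) : (A + B)^t* = A^t* + B^t*.
Proof. by rewrite linearD /= map_mxD. Qed.

Lemma adjN m n (A : 'M[C]_(m, n)) : (- A)^t* = - A^t*.
Proof. by rewrite linearN /= map_mxN. Qed.

Lemma adjZ m n (c : C) (A : 'M[C]_(m, n)) : (c *: A)^t* = (c^*)%R *: A^t*.
Proof. by rewrite linearZ /= map_mxZ. Qed.

Lemma conj_real (r : R) : ((r%:C)^*)%R = r%:C.
Proof. exact: conjc_real. Qed.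

Lemma hermsymmx_adj n (A : 'M[C]_n) : A \is hermsymmx -> A^t* = A.
Proof. by move=> /is_hermitianmxP; rewrite expr0 scale1r. Qed.

Lemma adj_hermsymmx n (A : 'M[C]_n) : A^t* = A -> A \is hermsymmx.
Proof. by move=> hA; apply/is_hermitianmxP; rewrite expr0 scale1r. Qed.

Variable d : nat.
Implicit Types (x y : 'cV[C]_d) (A B U : 'M[C]_d).

Lemma innerC x y : inner y x = ((inner x y)^*)%R.
Proof.
by rewrite /inner -[y in LHS]trmxCK -adjM !mxE.
Qed.

Lemma innerZl c x y : inner (c *: x) y = c * inner x y.
Proof. by rewrite /inner -scalemxAr mxE. Qed.

Lemma innerDl x x' y : inner (x + x') y = inner x y + inner x' y.
Proof. by rewrite /inner mulmxDr mxE. Qed.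

Lemma innerZr c x y : inner x (c *: y) = (c^*)%R * inner x y.
Proof. by rewrite innerC innerZl rmorphM [inner x y]innerC. Qed.

Lemma innerDr x y y' : inner x (y + y') = inner x y + inner x y'.
Proof. by rewrite innerC innerDl rmorphD [inner x y]innerC [inner x y']innerC. Qed.

Lemma inner_adj A x y : inner (A *m x) y = inner x (A^t* *m y).
Proof. by rewrite /inner adjM trmxCK mulmxA. Qed.

Lemma unitary_adjK U : U \is unitarymx -> U^t* *m U = 1%:M.
Proof. by move=> /unitarymxP/mulmx1C. Qed.

Lemma inner_unitary U x y : U \is unitarymx -> inner (U *m x) (U *m y) = inner x y.
Proof. by move=> hU; rewrite inner_adj mulmxA unitary_adjK // mul1mx. Qed.

Lemma vnormZ c x : vnorm (c *: x) = complex.Re `|c| * vnorm x.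
Proof.
rewrite /vnorm; have -> : complex.Re (inner (c *: x) (c *: x)) =
          complex.Re `|c| ^+ 2 * complex.Re (inner x x).
  rewrite innerZl innerZr mulrA -normCK normc_def; case: (inner x x) => u v /=.
  by rewrite expr2 /= !(mul0r, mulr0, subr0, addr0) expr2.
have r0 : 0 <= complex.Re `|c| by rewrite normc_def /= sqrtr_ge0.
by rewrite sqrtrM ?sqr_ge0 // sqrtr_sqr ger0_norm.
Qed.

Lemma adj_tensor x y : (tensor x y)^t* = tensor y x.
Proof. by rewrite /tensor adjM trmxCK. Qed.

Lemma tensor_mul A B x y : A *m tensor x y *m B^t* = tensor (A *m x) (B *m y).
Proof. by rewrite /tensor adjM !mulmxA. Qed.

Lemma mul_tensor A x y : A *m tensor x y = tensor (A *m x) y.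
Proof. by rewrite /tensor mulmxA. Qed.

Lemma tensor_mulr A x y : tensor x y *m A = tensor x (A^t* *m y).
Proof. by rewrite /tensor adjM trmxCK mulmxA. Qed.

Lemma tensorZl c x y : tensor (c *: x) y = c *: tensor x y.
Proof. by rewrite /tensor -scalemxAl. Qed.

Lemma tensorZr c x y : tensor x (c *: y) = (c^*)%R *: tensor x y.
Proof. by rewrite /tensor adjZ -scalemxAr. Qed.

Lemma sum_tensor_adj (I : finType) (P : pred I) (G : I -> 'cV[C]_d) :
  (\sum_(i | P i) tensor (G i) (G i))^t* = \sum_(i | P i) tensor (G i) (G i).
Proof.
rewrite (big_morph (fun M : 'M[C]_d => M^t*) (id1 := 0) (@adjD d d))
  ?trmx0 ?map_mx0 //.
by apply: eq_bigr => i _; rewrite adj_tensor.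
Qed.

End Adjoint.

(** * Matrices diagonalized by an orthonormal family *)

Section OrthonormalFamilies.
Local Open Scope sesquilinear_scope.
Variables (R : realType) (d : nat).
Local Notation C := R[i].
Implicit Types (A B : 'M[C]_d) (v : 'I_d -> 'cV[C]_d) (al : 'rV[R]_d).

Definition orthonormal v : Prop := forall i j, inner (v i) (v j) = (i == j)%:R.

Definition diagonalizes v A al : Prop :=
  forall i, A *m v i = (al 0 i)%:C *: v i.

Definition cols_mx v : 'M[C]_d := \matrix_(i, j) v j i 0.

Lemma adj_cols_mx v : orthonormal v -> (cols_mx v)^t* *m cols_mx v = 1%:M.
Proof.
move=> ov; apply/matrixP => i j; rewrite !mxE eq_sym -ov /inner mxE.
by apply: eq_bigr => l _; rewrite !mxE.
Qed.

(** The left inverse of a square matrix is a right inverse: orthonormality of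
    [d] vectors in dimension [d] is already completeness. *)
Lemma sum_tensor_orthonormal v :
  orthonormal v -> \sum_i tensor (v i) (v i) = 1%:M.
Proof.
move=> ov; rewrite -(mulmx1C (adj_cols_mx ov)).
apply/matrixP => i j; rewrite summxE mxE; apply: eq_bigr => l _.
by rewrite !mxE big_ord1 !mxE.
Qed.

Lemma orthonormal_basisP v : orthonormal v -> orthonormal_basis v.
Proof.
move=> ov; split; first exact: ov.
rewrite basisEdim; apply/andP; split; last first.
  by rewrite size_codom card_ord dimvf dim_matrix mulr1.
apply/subvP => x _; rewrite -[x]mul1mx -(sum_tensor_orthonormal ov) mulmx_suml.
apply: memv_suml => i _; rewrite tensorE; apply: memvZ; apply: memv_span.
exact: codom_f.
Qed.

Lemma eq_on_orthonormal v A B :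
  orthonormal v -> (forall i, A *m v i = B *m v i) -> A = B.
Proof.
move=> ov AB; rewrite -[A]mulmx1 -[B]mulmx1 -(sum_tensor_orthonormal ov).
by rewrite !mulmx_sumr; apply: eq_bigr => i _; rewrite !mul_tensor AB.
Qed.

Lemma diagonalizes_sum v A al : orthonormal v -> diagonalizes v A al ->
  A = \sum_i (al 0 i)%:C *: tensor (v i) (v i).
Proof.
move=> ov dA; rewrite -[LHS]mulmx1 -(sum_tensor_orthonormal ov) mulmx_sumr.
by apply: eq_bigr => i _; rewrite mul_tensor dA tensorZl.
Qed.

(** The vectors of [v] are the columns of an invertible matrix that conjugates
    [A] to a diagonal matrix. *)
Lemma char_poly_diagonalizes v A al : orthonormal v -> diagonalizes v A al ->
  char_poly A = \prod_i ('X - ((al 0 i)%:C)%:P).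
Proof.
move=> ov dA; pose D : 'M[C]_d := diag_mx (\row_i (al 0 i)%:C).
have AV : A *m cols_mx v = cols_mx v *m D.
  apply/matrixP => i j; rewrite mul_mx_diag !mxE.
  have := congr1 (fun x : 'cV[C]_d => x i 0) (dA j); rewrite !mxE mulrC => <-.
  by apply: eq_bigr => l _; rewrite !mxE.
have detV : \det (cols_mx v) != 0.
  apply: contraNneq (oner_neq0 C) => V0.
  by rewrite -(det1 C d) -(adj_cols_mx ov) det_mulmx V0 mulr0.
have -> : char_poly A = char_poly D.
  have nzV : (\det (cols_mx v))%:P != 0 by rewrite polyC_eq0.
  apply: (mulIf nzV); rewrite -det_map_mx /char_poly -det_mulmx mulrC -det_mulmx.
  congr (\det _); rewrite /char_poly_mx mulmxBl mulmxBr -!map_mxM AV.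
  by rewrite mul_scalar_mx mul_mx_scalar.
rewrite char_poly_trig ?diag_mx_is_trig //.
by apply: eq_bigr => i _; rewrite !mxE eqxx.
Qed.

Lemma perm_decr_rearr al al' :
  perm_eq [seq al 0 i | i <- enum 'I_d] [seq al' 0 i | i <- enum 'I_d] ->
  decr_rearr al = decr_rearr al'.
Proof.
move=> p; rewrite /decr_rearr; apply/rowP => i; rewrite !mxE; congr (_`_i).
apply/perm_sortP => //.
- by move=> x y /=; exact: le_total.
- by move=> y x z /= xy yz; exact: le_trans yz xy.
- by move=> x y /= /le_anti.
Qed.

(** The characteristic polynomial determines its roots up to order, and
    sorting forgets the order. *)
Lemma lambda_diagonalizes v A al : orthonormal v -> diagonalizes v A al ->
  lambda A = decr_rearr al.
Proof.
move=> ov dA; apply: perm_decr_rearr.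
have -> : [seq (\row_j complex.Re (eigenvalues A)`_j) 0 i | i <- enum 'I_d]
    = map (@complex.Re R) (eigenvalues A).
  apply: (@eq_from_nth _ 0) => [|i].
    by rewrite [RHS]size_map size_eigenvalues size_map size_enum_ord.
  rewrite size_map size_enum_ord => id.
  rewrite (nth_map (Ordinal id)) ?size_enum_ord // mxE nth_enum_ord //.
  by rewrite (nth_map 0) ?size_eigenvalues.
have -> : [seq al 0 i | i <- enum 'I_d] =
    map (@complex.Re R) [seq (al 0 i)%:C | i <- enum 'I_d].
  by rewrite -(map_comp (@complex.Re R) (fun i => (al 0 i)%:C)).
apply/perm_map/prod_XsubC_eq.
by rewrite -char_poly_eigenvalues (char_poly_diagonalizes ov dA) big_map big_enum.
Qed.

Lemma decr_rearr_permE al :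
  exists s : 'S_d, forall i, decr_rearr al 0 i = al 0 (s i).
Proof.
pose t := mktuple (fun i => al 0 i).
have /tuple_permP[s st] : perm_eq [seq decr_rearr al 0 i | i <- enum 'I_d] t.
  exact: decr_rearr_perm.
exists s => i; have := congr1 (fun r => r`_i) st.
rewrite (nth_map i 0 (fun j => decr_rearr al 0 j)) ?size_enum_ord //.
by rewrite nth_ord_enum => ->; rewrite -tnth_nth !tnth_mktuple.
Qed.


Definition nonincreasing al : Prop :=
  forall i j : 'I_d, (i <= j)%N -> al 0 j <= al 0 i.

Lemma decr_rearr_id al : nonincreasing al -> decr_rearr al = al.
Proof.
move=> dal; apply/rowP => i; rewrite mxE sorted_sort.
- by rewrite (nth_map i) ?size_enum_ord // nth_ord_enum.
- by move=> y x z /= xy yz; exact: le_trans yz xy.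
apply/(sortedP 0) => l; rewrite size_map size_enum_ord => ld.
have ld' := ltnW ld.
rewrite !(nth_map (Ordinal ld) 0 (fun j => al 0 j)) ?size_enum_ord //=.
by apply: dal; rewrite !nth_enum_ord.
Qed.

(** The spectral theorem gives the eigenbasis as the rows of a unitary matrix
    [P] with [A = P^-1 D P], so its vectors are the adjoints of these rows;
    permuting them sorts the eigenvalues. *)
Lemma spectral_sorted A : A^t* = A ->
  exists v al, [/\ orthonormal v, diagonalizes v A al & nonincreasing al].
Proof.
move=> /adj_hermsymmx hA; set P := spectralmx A.
have PU : P \is unitarymx by exact: spectral_unitarymx.
have EA := orthomx_spectralP (hermitian_normalmx hA).
pose v i : 'cV[C]_d := (row i P)^t*.
have ov : orthonormal v.
  move=> i j; have /unitarymxP/(congr1 (fun M : 'M_d => M j i)) := PU.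
  rewrite !mxE eq_sym => <-; rewrite /inner mxE; apply: eq_bigr => l _.
  by rewrite !mxE conjCK mulrC.
pose al : 'rV[R]_d := \row_i complex.Re (spectral_diag A 0 i).
have dA : diagonalizes v A al.
  move=> i; have -> : (al 0 i)%:C = spectral_diag A 0 i.
    have /mxOverP/(_ 0 i) := hermitian_spectral_diag_real hA.
    by move=> /RRe_real; rewrite /al mxE => ->.
  have PV l : P *m v l = delta_mx l 0.
    apply/colP => m; rewrite mxE /= [RHS]mxE eqxx andbT eq_sym -ov /inner mxE.
    by apply: eq_bigr => r _; rewrite !mxE conjCK mulrC.
  rewrite {1}EA -/P -!mulmxA PV -[v i]mul1mx -(mulVmx (spectral_unit A)) -/P.
  rewrite -mulmxA PV scalemxAr; congr (_ *m _).
  apply/colP => l; rewrite mul_diag_mx !mxE eqxx andbT.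
  by case: eqP => [->|]; rewrite ?mulr0.
have [s sal] := decr_rearr_permE al.
exists (v \o s), (decr_rearr al); split.
- by move=> i j /=; rewrite ov (inj_eq perm_inj).
- by move=> i; rewrite sal; exact: dA.
- exact: decr_rearr_decr.
Qed.

Lemma lambda_sorted v A al : orthonormal v -> diagonalizes v A al ->
  nonincreasing al -> lambda A = al.
Proof. by move=> ov dA dal; rewrite (lambda_diagonalizes ov dA) decr_rearr_id. Qed.

End OrthonormalFamilies.

(** * Strict convexity along a unitary orbit *)

Section StrictConvexity.
Local Open Scope sesquilinear_scope.
Variables (R : realType) (d : nat).
Local Notation C := R[i].
Variable N : 'M[C]_d -> R.
Hypotheses (N_norm : is_norm N) (N_unitary : unitarily_invariant N).
Hypothesis N_strict : strictly_convex N.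
Implicit Types (A B X U : 'M[C]_d) (v : 'cV[C]_d).

Lemma normZ_real (r : R) X : 0 <= r -> N (r%:C *: X) = r * N X.
Proof.
move=> r0; case: N_norm => _ _ -> _; congr (_ * _).
by rewrite normc_def /= expr0n addr0 sqrtr_sqr ger0_norm.
Qed.

(** Strict convexity, which is assumed on the unit sphere, holds by homogeneity
    on every sphere. *)
Lemma norm_convex_lt X Y (t : R) : N X = N Y -> X <> Y -> 0 < t -> t < 1 ->
  N (t%:C *: X + (1 - t)%:C *: Y) < N X.
Proof.
move=> NXY XY t0 t1; have [N0 Nd _ _] := N_norm.
have NX : 0 < N X.
  rewrite lt_neqAle N0 andbT eq_sym; apply/eqP => NX0.
  by apply: XY; rewrite (Nd _ NX0) (Nd Y) // -NXY.
pose r := N X; have r0 : r != 0 by rewrite gt_eqF.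
have unit Z : N Z = r -> N ((r^-1)%:C *: Z) = 1.
  by move=> NZ; rewrite normZ_real ?invr_ge0 ?N0 // NZ mulVf.
have sK (Z : 'M[C]_d) : r%:C *: ((r^-1)%:C *: Z) = Z.
  by rewrite scalerA -rmorphM mulfV // scale1r.
have scaleC (x y : C) (Z : 'M[C]_d) : x *: (y *: Z) = y *: (x *: Z).
  by rewrite !scalerA mulrC.
have ne : (r^-1)%:C *: X <> (r^-1)%:C *: Y.
  by move=> E; apply: XY; rewrite -(sK X) E sK.
have := N_strict (unit _ (erefl _)) (unit Y (esym NXY)) ne t0 t1.
rewrite -(ltr_pM2l NX) mulr1 -normZ_real ?N0 // scalerDr.
by rewrite (scaleC _ t%:C) (scaleC _ (1 - t)%:C) !sK.
Qed.

Lemma convex_comb_decomp A B (c : R) :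
  let T := (1 - c)%:C *: A + c%:C *: B in
  A = T + c%:C *: (A - B) /\ B = T - (1 - c)%:C *: (A - B).
Proof.
by split; apply/matrixP => i j; rewrite !mxE rmorphB rmorph1; ring.
Qed.

(** The heart of the proof: if [U] commutes with a point strictly inside the
    segment from [A] to [B], then [A - U B U^-1] lies strictly inside the segment
    from [A - B] to [U (A - B) U^-1], two matrices of the same norm. *)
Lemma unitary_min_fixes A B U (c : R) : U \is unitarymx -> 0 < c -> c < 1 ->
  comm_mx U ((1 - c)%:C *: A + c%:C *: B) ->
  N (A - B) <= N (A - U *m B *m U^t*) ->
  U *m (A - B) *m U^t* = A - B.
Proof.
move=> hU c0 c1 cU le; apply/eqP/negPn/negP => /eqP neq.
have key : A - U *m B *m U^t* =
    c%:C *: (A - B) + (1 - c)%:C *: (U *m (A - B) *m U^t*).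
  have [EA EB] := convex_comb_decomp A B c.
  set T := (1 - c)%:C *: A + c%:C *: B in cU EA EB.
  have UT : U *m T *m U^t* = T by rewrite cU -mulmxA (unitarymxP hU) mulmx1.
  rewrite [in LHS]EA {2}EB mulmxBr mulmxBl UT -scalemxAr -scalemxAl.
  by rewrite opprB addrC addrA subrK addrC.
have NU : N (A - B) = N (U *m (A - B) *m U^t*).
  by rewrite N_unitary ?trmxC_unitary.
have := norm_convex_lt NU (nesym neq) c0 c1.
by rewrite -key ltNge le.
Qed.

(** * Minimality along phase rotations of a single direction *)

Definition phase (z : C) v : 'M[C]_d := 1%:M + (z - 1) *: tensor v v.

Lemma tensor_idem v : inner v v = 1 -> tensor v v *m tensor v v = tensor v v.
Proof. by move=> v1; rewrite mul_tensor tensorE v1 scale1r. Qed.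

Lemma phase_unitarymx z v : inner v v = 1 -> `|z| = 1 -> phase z v \is unitarymx.
Proof.
move=> v1 z1; apply/unitarymxP.
rewrite /phase adjD adjZ adj_tensor trmx1 map_mx1 mulmxDl mul1mx mulmxDr mulmx1.
rewrite -scalemxAl -scalemxAr tensor_idem // scalerA -!addrA -!scalerDl.
rewrite -[RHS]addr0; congr (_ + _); rewrite [X in X *: _](_ : _ = 0) ?scale0r //.
have zz : z * (z^*)%R = 1 by rewrite -normCK z1 expr1n.
by rewrite rmorphB rmorph1 mulrBr mulrBl zz; ring.
Qed.

(** The witness is [w / w^*] for [w = 1 + i s] with [s] small, which has modulus
    one for free; its distance to [1] is [2 s / |w| <= 2 s]. *)
Lemma circle_near1 (e : R) : 0 < e ->
  exists z : C, [/\ `|z| = 1, z != 1 & complex.Re `|z - 1| < e].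
Proof.
move=> e0; pose s := e / 3; have s0 : 0 < s by rewrite divr_gt0.
pose w : C := 1 +i* s; have w0 : w != 0 by rewrite eq_complex /= oner_eq0.
have wJ : (w^*)%R = 1 -i* s by [].
have wJ0 : (w^*)%R != 0 by rewrite conjC_eq0.
have zE : w / (w^*)%R - 1 = (0 +i* (s *+ 2)) / (w^*)%R.
  rewrite -[X in _ - X](mulfV wJ0) -mulrBl wJ; congr (_ / _).
  by apply/eqP; rewrite eq_complex /=; apply/andP; split; apply/eqP; ring.
exists (w / (w^*)%R); split.
- by rewrite normf_div norm_conjC divff // normr_eq0.
- rewrite -subr_eq0 zE mulf_neq0 ?invr_eq0 // eq_complex /= negb_and.
  by rewrite (gt_eqF (_ : 0 < s *+ 2)) ?orbT // mulrn_wgt0.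
have w1 : 1 <= `|(w^*)%R|.
  by rewrite norm_conjC; apply: le_trans (normc_ge_Re w); rewrite /= normr1.
have s2 : 0 <= s *+ 2 by rewrite mulrn_wge0 // ltW.
have nE : `|0 +i* (s *+ 2) : C| = (s *+ 2)%:C.
  by rewrite normc_def /= expr0n add0r sqrtr_sqr ger0_norm.
have : `|(0 +i* (s *+ 2)) / (w^*)%R| <= (s *+ 2)%:C.
  rewrite normf_div nE ler_pdivrMr ?(lt_le_trans ltr01) //.
  by rewrite ler_peMr // ler0c.
rewrite zE lecE /= => /andP[_ /le_lt_trans]; apply.
by rewrite /s mulr2n; lra.
Qed.

Lemma vnorm_phase z v x : inner v v = 1 ->
  vnorm (x - phase z v *m x) = complex.Re `|z - 1| * complex.Re `|inner x v|.
Proof.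
move=> v1; rewrite /phase mulmxDl mul1mx opprD addrA subrr sub0r.
rewrite -scalemxAl tensorE scalerA -scaleNr vnormZ normrN normrM.
have -> : vnorm v = 1 by rewrite /vnorm v1 /= sqrtr1.
by rewrite mulr1 !normc_def -rmorphM.
Qed.

(** What local minimality of [B] on its unitary orbit says about the phase
    rotations.  One nontrivial rotation for each unit vector is enough, because a matrix commutes with [phase z v], for any [z <> 1], exactly when
    it commutes with [tensor v v]. *)
Definition phase_minimal A B : Prop :=
  forall v, inner v v = 1 -> exists z : C, [/\ `|z| = 1, z != 1 &
    N (A - B) <= N (A - phase z v *m B *m (phase z v)^t*)].

(** Rotating only the vectors indexed by [P], by a phase close to [1], gives a
    family with the same norms as close to [G] as wanted. *)
Lemma local_minimizer_phase_minimal k (a : 'rV[R]_k) S (G : 'I_k -> 'cV[C]_d)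
    (P : pred 'I_k) : local_minimizer a (Theta N S) G ->
  phase_minimal (S - \sum_(i | ~~ P i) tensor (G i) (G i))
                (\sum_(i | P i) tensor (G i) (G i)).
Proof.
move=> [aG [e e0 minG]] v v1.
(* [m] bounds every [|<g_i, v>|], and the [1] keeps it positive. *)
pose m := 1 + \sum_i complex.Re `|inner (G i) v|.
have re0 (z : C) : 0 <= complex.Re `|z| by rewrite normc_def sqrtr_ge0.
have m0 : 0 < m by rewrite ltr_pwDl // sumr_ge0.
have [z [z1 zn1 ze]] := circle_near1 (divr_gt0 e0 m0).
exists z; split=> //; have hU := phase_unitarymx v1 z1.
set U := phase z v in hU *.
pose G' i := if P i then U *m G i else G i.
have FG : S - frame_op G =
    S - \sum_(i | ~~ P i) tensor (G i) (G i) - \sum_(i | P i) tensor (G i) (G i).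
  by rewrite /frame_op (bigID P) /= opprD addrA addrAC.
have FG' : S - frame_op G' = S - \sum_(i | ~~ P i) tensor (G i) (G i)
    - U *m (\sum_(i | P i) tensor (G i) (G i)) *m U^t*.
  rewrite /frame_op (bigID P) /= opprD addrA addrAC mulmx_sumr mulmx_suml.
  congr (_ - _ - _); apply: eq_bigr => i Pi; rewrite /G' ?(negbTE Pi) //.
  by rewrite Pi tensor_mul.
rewrite -FG -FG'; apply: minG => [i|].
  by rewrite -aG /G' /vnorm; case: (P i) => //; rewrite inner_unitary.
apply: bigmax_lt => // i _; rewrite /G'; case: (P i); last first.
  by rewrite subrr -(scale0r (G i)) vnormZ normr0 mul0r.
rewrite vnorm_phase //; apply: le_lt_trans (_ : complex.Re `|z - 1| * m < e).
  rewrite ler_wpM2l // /m (bigD1 i) // addrCA lerDl.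
  by rewrite addr_ge0 // sumr_ge0.
by rewrite -ltr_pdivlMr.
Qed.

Lemma phase_minimal_comm A B (c t : R) v : A^t* = A -> B^t* = B ->
  phase_minimal A B -> 0 < c -> c < 1 -> inner v v = 1 ->
  ((1 - c)%:C *: A + c%:C *: B) *m v = t%:C *: v ->
  comm_mx (A - B) (tensor v v).
Proof.
move=> hA hB minAB c0 c1 v1; set T := _ + _ => Tv.
have hT : T^t* = T by rewrite adjD !adjZ hA hB !conj_real.
have cT : comm_mx T (tensor v v).
  by rewrite /comm_mx mul_tensor tensor_mulr hT Tv tensorZl tensorZr conj_real.
have [z [z1 zn1 le]] := minAB v v1; have hU := phase_unitarymx v1 z1.
have cU Z : comm_mx (phase z v) Z <-> comm_mx Z (tensor v v).
  rewrite /comm_mx /phase mulmxDl mulmxDr mul1mx mulmx1 -scalemxAl -scalemxAr.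
  split=> [/addrI/scalerI E|->] //.
  by rewrite E ?subr_eq0.
apply/cU; have /(congr1 (mulmx^~ (phase z v))) :=
  unitary_min_fixes hU c0 c1 (proj2 (cU T) cT) le.
by rewrite -mulmxA unitary_adjK // mulmx1.
Qed.

(** Commuting with the projection on the line of [v] means preserving that
    line; the eigenvalue is real because [A - B] is selfadjoint. *)
Lemma phase_minimal_eigen A B (c t : R) v : A^t* = A -> B^t* = B ->
  phase_minimal A B -> 0 < c -> c < 1 -> inner v v = 1 ->
  ((1 - c)%:C *: A + c%:C *: B) *m v = t%:C *: v ->
  (A - B) *m v = (complex.Re (inner ((A - B) *m v) v))%:C *: v.
Proof.
move=> hA hB minAB c0 c1 v1 Tv; set X := A - B.
have hX : X^t* = X by rewrite adjD adjN hA hB.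
rewrite RRe_real; last first.
  by apply/CrealP; rewrite -innerC inner_adj hX.
have := phase_minimal_comm hA hB minAB c0 c1 v1 Tv.
move=> /(congr1 (mulmx^~ v)); rewrite -/X /= mul_tensor tensorE v1 scale1r => E.
by rewrite {1}E -mulmxA tensorE.
Qed.

(** If the eigenvalues of [A] and [B] on [v i] and [v j] were oppositely
    ordered, some convex combination of [A] and [B] would be scalar on the plane
    they span; all the vectors of that plane would then be eigenvectors of
    [A - B], whose eigenvalues on [v i] and [v j] differ. *)
Lemma phase_minimal_no_crossing A B (v : 'I_d -> 'cV[C]_d) al be (i j : 'I_d) :
  A^t* = A -> B^t* = B -> phase_minimal A B ->
  orthonormal v -> diagonalizes v A al -> diagonalizes v B be ->
  al 0 j < al 0 i -> be 0 j <= be 0 i.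
Proof.
move=> hA hB minAB ov dA dB lal; rewrite leNgt; apply/negP => lbe.
have Xv l : (A - B) *m v l = (al 0 l - be 0 l)%:C *: v l.
  by rewrite mulmxBl dA dB -scalerBl rmorphB.
(* [c] solves [(1 - c) al_i + c be_i = (1 - c) al_j + c be_j]. *)
pose p := al 0 i - al 0 j; pose q := be 0 j - be 0 i.
have p0 : 0 < p by rewrite subr_gt0.
have q0 : 0 < q by rewrite subr_gt0.
have pq0 : 0 < p + q by rewrite addr_gt0.
pose c := p / (p + q).
have c0 : 0 < c by rewrite divr_gt0.
have c1 : c < 1 by rewrite ltr_pdivrMr // mul1r ltrDl.
pose tau := (1 - c) * al 0 i + c * be 0 i.
have tauE : tau = (1 - c) * al 0 j + c * be 0 j.
  have : c * (p + q) = p by rewrite divfK // gt_eqF.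
  by rewrite /tau /p /q; lra.
have ij : i != j by apply: contraTneq lal => ->; rewrite ltxx.
pose r := (Num.sqrt 2)^-1 : R.
have rr : r * r = 2^-1 by rewrite -invfM -expr2 sqr_sqrtr.
pose w := r%:C *: (v i + v j).
have w1 : inner w w = 1.
  rewrite innerZl innerZr conj_real mulrA innerDl !innerDr !ov !eqxx.
  rewrite (negbTE ij) eq_sym (negbTE ij) addr0 add0r -rmorphM rr mulrDr mulr1.
  by rewrite -rmorphD (_ : _ + _ = 1) ?rmorph1 //; lra.
have Tw : ((1 - c)%:C *: A + c%:C *: B) *m w = tau%:C *: w.
  rewrite /w -scalemxAr scalerA mulrC -scalerA; congr (_ *: _).
  rewrite mulmxDr !mulmxDl -!scalemxAl !dA !dB !scalerA -!scalerDl scalerDr.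
  by rewrite -!rmorphM -!rmorphD -tauE.
have := phase_minimal_eigen hA hB minAB c0 c1 w1 Tw.
set mu := complex.Re _; rewrite /w -scalemxAr mulmxDr !Xv => E.
have rn0 : r%:C != 0 :> C by rewrite fmorph_eq0 invr_eq0 gt_eqF // sqrtr_gt0.
move: E; rewrite scalerA mulrC -scalerA => /(scalerI rn0) E.
have xi : al 0 i - be 0 i = mu.
  have := congr1 (fun y : 'cV[C]_d => inner y (v i)) E.
  rewrite /= innerZl !innerDl !innerZl !ov eqxx (eq_sym j) (negbTE ij).
  by rewrite mulr0 addr0 mulr1 addr0 mulr1 => /complexI.
have xj : al 0 j - be 0 j = mu.
  have := congr1 (fun y : 'cV[C]_d => inner y (v j)) E.
  rewrite /= innerZl !innerDl !innerZl !ov eqxx (negbTE ij).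
  by rewrite mulr0 add0r mulr1 add0r mulr1 => /complexI.
by move: lal lbe xi xj; lra.
Qed.

(** A local form of the equality case of Lidskii's inequality.  The eigenbasis of
    [(A + B) / 2], listed by decreasing eigenvalue, does it: an increase of
    [al] along the list would be a decrease of [be], and conversely, that is, a
    crossing. *)
Lemma phase_minimal_diag A B : A^t* = A -> B^t* = B -> phase_minimal A B ->
  exists (v : 'I_d -> 'cV[C]_d) al be, [/\ orthonormal v, diagonalizes v A al,
    diagonalizes v B be, nonincreasing al & nonincreasing be].
Proof.
move=> hA hB minAB; pose c : R := 2^-1.
have c0 : 0 < c by rewrite invr_gt0.
have c1 : c < 1 by rewrite /c; lra.
have [EA EB] := convex_comb_decomp A B c.
set T := (1 - c)%:C *: A + c%:C *: B in EA EB.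
have hT : T^t* = T by rewrite adjD !adjZ hA hB !conj_real.
have [v [t [ov dT dt]]] := spectral_sorted hT.
pose x i := complex.Re (inner ((A - B) *m v i) (v i)).
have Xv i : (A - B) *m v i = (x i)%:C *: v i.
  by apply: phase_minimal_eigen hA hB minAB c0 c1 _ (dT i); rewrite ov eqxx.
pose al : 'rV[R]_d := \row_i (t 0 i + c * x i).
pose be : 'rV[R]_d := \row_i (t 0 i - (1 - c) * x i).
have dA : diagonalizes v A al.
  move=> i; rewrite EA mulmxDl dT -scalemxAl Xv scalerA -scalerDl mxE.
  by rewrite -rmorphM -rmorphD.
have dB : diagonalizes v B be.
  move=> i; rewrite EB mulmxBl dT -scalemxAl Xv scalerA -scalerBl mxE.
  by rewrite -rmorphM -rmorphB.
have nocross i j := phase_minimal_no_crossing (i := i) (j := j) hA hB minAB ov dA dB.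
exists v, al, be; split=> // i j /dt ltij; rewrite leNgt; apply/negP => l.
  by have := nocross j i l; move: l; rewrite !mxE /c; lra.
have : al 0 j < al 0 i by move: l; rewrite !mxE /c; lra.
by move/nocross; rewrite leNgt l.
Qed.

End StrictConvexity.

(** * Local minimizers of the frame operator distance *)

Lemma diagonalizes_comm (R : realType) (d : nat) (v : 'I_d -> 'cV[R[i]]_d)
    (A B : 'M[R[i]]_d) (al be : 'rV[R]_d) : orthonormal v ->
  diagonalizes v A al -> diagonalizes v B be -> comm_mx A B.
Proof.
move=> ov dA dB; apply: (eq_on_orthonormal ov) => i.
by rewrite -!mulmxA dA dB -!scalemxAr dA dB !scalerA mulrC.
Qed.

(** Both sides of the commutation relation, applied to [g], are multiples of
    [X g] and of [g]. *)
Lemma comm_tensor_eigenvector (R : realType) (d : nat) (X : 'M[R[i]]_d)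
    (g : 'cV[R[i]]_d) :
  0 < vnorm g -> comm_mx X (tensor g g) -> eigenvector X g.
Proof.
move=> g0 cX; have gg : inner g g != 0.
  by apply: contraTneq g0 => gg; rewrite /vnorm gg sqrtr0 ltxx.
split; first by apply: contraNneq gg => ->; rewrite /inner mulmx0 mxE.
exists ((inner g g)^-1 * inner (X *m g) g).
move: cX => /(congr1 (mulmx^~ g)); rewrite /= mul_tensor tensorE -mulmxA tensorE.
by move=> E; rewrite -scalerA -E scalerA mulVf // scale1r.
Qed.

Theorem theorem4p5 (R : realType) (d k : nat) (S : 'M[R[i]]_d) (a : 'rV[R]_k)
    (N : 'M[R[i]]_d -> R) (G0 : 'I_k -> 'cV[R[i]]_d)
    (S_psd : psdmx S) (a_pos_decr : pos_decr a)
    (N_norm : is_norm N) (N_unitary : unitarily_invariant N)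
    (N_strict : strictly_convex N)
    (G0_min : local_minimizer a (Theta N S) G0) :
  let S0 := frame_op G0 in
  [/\ forall j : 'I_k,
        comm_mx (S - S0) (tensor (G0 j) (G0 j)) /\ eigenvector (S - S0) (G0 j),
      exists v : 'I_d -> 'cV[R[i]]_d,
        [/\ orthonormal_basis v,
            S = \sum_(i < d) (lambda S 0 i)%:C *: tensor (v i) (v i)
          & S0 = \sum_(i < d) (lambda S0 0 i)%:C *: tensor (v i) (v i)]
    & lambda (S - S0) = decr_rearr (lambda S - lambda S0)].
Proof.
move=> S0; have hS := hermsymmx_adj (proj1 S_psd).
pose W (P : pred 'I_k) := \sum_(i | P i) tensor (G0 i) (G0 i).
have hW P : ((W P)^t*)%sesqui = W P by exact: sum_tensor_adj.
have diag P : exists (v : 'I_d -> 'cV[R[i]]_d) al be,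
    [/\ orthonormal v, diagonalizes v (S - W (predC P)) al,
        diagonalizes v (W P) be, nonincreasing al & nonincreasing be].
  apply: (phase_minimal_diag N_norm N_unitary N_strict).
  - by rewrite adjD adjN hS hW.
  - exact: hW.
  - exact: local_minimizer_phase_minimal G0_min.
have [v [al [be [ov dS dS0 mal mbe]]]] := diag predT.
have W0 : W (predC predT) = 0 by rewrite /W big_pred0_eq.
rewrite W0 subr0 in dS.
rewrite (lambda_sorted ov dS mal) (lambda_sorted ov dS0 mbe).
split.
- move=> j; suff cj : comm_mx (S - S0) (tensor (G0 j) (G0 j)).
    split=> //; apply: comm_tensor_eigenvector cj.
    rewrite lt_neqAle sqrtr_ge0 andbT eq_sym.
    have := proj1 a_pos_decr j; rewrite -(proj1 G0_min j).
    by apply: contraTneq => ->; rewrite expr0n ltxx.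
  have [u [ga [de [ou dA dB _ _]]]] := diag (pred1 j).
  have Wj : W (pred1 j) = tensor (G0 j) (G0 j) by rewrite /W big_pred1_eq.
  have SE : S - S0 = S - W (predC (pred1 j)) - W (pred1 j).
    by rewrite /S0 /frame_op (bigID (pred1 j)) /= opprD addrA addrAC.
  rewrite SE -Wj; apply: comm_mx_sym; apply: comm_mxB => //.
  exact: diagonalizes_comm ou dB dA.
- by exists v; split; [exact: orthonormal_basisP | exact: diagonalizes_sum..].
apply: (lambda_diagonalizes ov) => i.
by rewrite mulmxBl dS dS0 -scalerBl !mxE rmorphB.
Qed.
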